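(* $$\lim_{n\to\infty} \lambda_n = 2,$$ where $\lambda_n = \lim_{k\to\infty} F(n,k)^{1/k}$ for each positive integer $n$.
   Context: A column is an infinite vertical stack of cells (with a bottom cell, and unbounded upward), and a board is a finite sequence of columns (so the columns are distinguishable). A position on a board is a placement of finitely many tokens in cells such that each token is either red or yellow, no two tokens occupy the same cell, and the occupied cells in each column form a contiguous block starting from the bottom. Equivalently, a position on an $n$-column board is an $n$-tuple of finite words over $\{R,Y\}$, each column being read from bottom to top. A reachable position is one that can be obtained from the empty board by a finite sequence of moves, where each move inserts a token into the lowest empty cell of some column, and the inserted tokens alternate globally between red and yellow from move to move, the first move placing a red token. There is no win condition. $F(n,k)$ denotes the number of positions on an $n$-column board that are reachable in exactly $k$ moves. The limit $\lambda_n = \lim_{k\to\infty} F(n,k)^{1/k}$ exists for every positive integer $n$. *)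

(* Defs.v *)
From HB Require Import structures.
From mathcomp Require Import all_boot all_order all_algebra finmap.
From mathcomp Require Import all_classical all_reals all_analysis.
Set Implicit Arguments.
Unset Strict Implicit.
Unset Printing Implicit Defensive.
Import Order.TTheory GRing.Theory Num.Theory.
Import numFieldNormedType.Exports.
Local Open Scope classical_set_scope.
Local Open Scope ring_scope.

Notation color := bool (only parsing).
Definition Red : color := true.
Definition Yellow : color := false.

(* Each column is a word over {Red, Yellow}, read from bottom to top. *)
Definition position (n : nat) := {ffun 'I_n -> seq color}.

Definition empty_board (n : nat) : position n := [ffun=> [::]].

Definition insert (n : nat) (p : position n) (i : 'I_n) (c : color) :
    position n :=
  [ffun j => if j == i then rcons (p j) c else p j].

(* The color of the token inserted after k moves have already been made. *)
Definition turn (k : nat) : color := if odd k then Yellow else Red.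

Inductive reachable_in (n : nat) : nat -> position n -> Prop :=
| reachable_empty : reachable_in 0 (empty_board n)
| reachable_move (k : nat) (p : position n) (i : 'I_n) :
    reachable_in k p -> reachable_in k.+1 (insert p i (turn k)).

(* fset_set sends an infinite set to the empty one; this rules that case out
   in the definition of F. *)
Lemma finite_reachable_in (n k : nat) :
  finite_set [set p : position n | reachable_in k p].
Proof.
elim: k => [|k IHk].
  apply: (@sub_finite_set _ _ [set empty_board n]); last exact: finite_set1.
  by move=> p /= Hp; inversion Hp.
apply: (@sub_finite_set _ _
  [set insert p i (turn k) | p in [set p | reachable_in k p] & i in [set: 'I_n]]);
  last exact: finite_image2.
by move=> p /= Hp; inversion Hp as [|m q i Hq]; exists q => //; exists i.
Qed.

Definition F (n k : nat) : nat :=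
  #|` fset_set [set p : position n | reachable_in k p]|.

(* The growth rate lambda_n.  The operator lim is total; on a sequence of reals
   with no limit its value is 0. *)
Definition growth_rate (R : realType) (n : nat) : R :=
  lim ((F n k)%:R `^ k%:R^-1 @[k --> \oo]).

(* Main.v *)
(* Let F_at k h be the number of positions with column heights h that are
   reachable in k moves.  Stacking two positions, with the colors of the upper
   one swapped when the lower one has an odd number of tokens, gives a reachable
   position, and once the heights are fixed no information is lost; hence
   F_at k h * F_at m g <= F_at (k + m) (h + g).  Only polynomially many height
   vectors occur (pigeonhole), so Fekete's argument shows that ln (F n k) / k
   tends to the supremum of the rates ln (F_at k h) / k.  Those rates are at
   most ln 2, since a position with known heights is a word of k colors.  A
   single full row with ceil(n/2) red tokens is always reachable, which gives
   F_at n (1, ..., 1) >= C(n, ceil(n/2)) >= 2^n / (n + 1) and a rate of at least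
   ln 2 - ln (n + 1) / n. *)
Require Import Defs.
From mathcomp Require Import all_boot all_order all_algebra finmap.
From mathcomp Require Import all_classical all_reals all_analysis.
From mathcomp Require Import zify lra.
Set Implicit Arguments.
Unset Strict Implicit.
Unset Printing Implicit Defensive.
Import Order.TTheory GRing.Theory Num.Theory.
Import numFieldNormedType.Exports.
Local Open Scope nat_scope.

(** * Counting positions by column heights *)

Definition heights n (p : position n) : {ffun 'I_n -> nat} :=
  [ffun i => size (p i)].

Definition positions n k : seq (position n) :=
  fset_set [set p : position n | reachable_in k p]%classic.

Definition F_at n k (h : {ffun 'I_n -> nat}) : nat :=
  count (fun p => heights p == h) (positions n k).

Lemma positions_uniq n k : uniq (positions n k).
Proof. exact: fset_uniq. Qed.

Lemma mem_positions n k (p : position n) :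
  (p \in positions n k) <-> reachable_in k p.
Proof.
rewrite /positions in_fset_set; last exact: finite_reachable_in.
by split; rewrite inE.
Qed.

Lemma size_positions n k : size (positions n k) = F n k.
Proof. by []. Qed.

Lemma F_at_le_F n k (h : {ffun 'I_n -> nat}) : F_at k h <= F n k.
Proof. exact: count_size. Qed.

Lemma size_le_F_at n k (h : {ffun 'I_n -> nat}) (s : seq (position n)) :
    uniq s ->
    (forall p, p \in s -> reachable_in k p /\ heights p = h) ->
  size s <= F_at k h.
Proof.
move=> s_uniq s_good; rewrite /F_at -size_filter; apply: uniq_leq_size => // p.
by move=> /s_good[p_reach p_h]; rewrite mem_filter p_h eqxx; exact/mem_positions.
Qed.

Lemma sum_heights n k (p : position n) :
  reachable_in k p -> \sum_i heights p i = k.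
Proof.
elim=> [|{}k {}p i _ IHp]; first by rewrite big1 // => i _; rewrite !ffunE.
under eq_bigr => j _.
  rewrite !ffunE (_ : size _ = (j == i) + heights p j); first over.
  by rewrite ffunE; case: eqP => //; rewrite size_rcons.
by rewrite big_split /= IHp -big_mkcond /= sum1_card card1.
Qed.

(** Concatenating the columns gives a word of [k] colors, and [h] tells where to cut it again. *)
Lemma F_at_le_expn n k (h : {ffun 'I_n -> nat}) : F_at k h <= 2 ^ k.
Proof.
rewrite -card_bool -card_tuple /F_at -size_filter.
set s := seq.filter _ _.
have s_good p : p \in s -> reachable_in k p /\ heights p = h.
  by rewrite mem_filter => /andP[/eqP ? /mem_positions].
pose f (p : position n) := flatten (map p (enum 'I_n)).
have f_size p : p \in s -> size (f p) = k.
  move=> /s_good[/sum_heights <- _].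
  rewrite size_flatten /shape -map_comp sumnE big_map big_enum /=.
  by apply: eq_bigr => i _; rewrite ffunE.
have f_inj : {in s &, injective f}.
  move=> p q /s_good[_ p_h] /s_good[_ q_h] eq_f.
  apply/ffunP => i.
  have /eq_in_map -> // : map p (enum 'I_n) = map q (enum 'I_n).
    apply: eq_from_flatten_shape eq_f _.
    rewrite /shape -!map_comp; apply: eq_map => j /=.
    have := congr1 (fun h' : {ffun _} => h' j) (etrans p_h (esym q_h)).
    by rewrite !ffunE.
  by rewrite mem_enum.
rewrite cardE -(size_map f s) -(size_map val (enum {: k.-tuple bool})).
apply: uniq_leq_size.
  by rewrite map_inj_in_uniq // filter_uniq // positions_uniq.
move=> _ /mapP[p ps ->]; apply/mapP.
have /eqP p_k := f_size p ps.
by exists (Tuple p_k); rewrite ?mem_enum.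
Qed.

(** After [k] moves every height is at most [k], so at most [k.+1 ^ n] height vectors occur; [h] is
    one shared by the most positions. *)
Lemma F_le_F_at n k :
  exists h : {ffun 'I_n -> nat}, F n k <= k.+1 ^ n * F_at k h.
Proof.
pose I := {ffun 'I_n -> 'I_k.+1}.
pose emb (g : I) : {ffun 'I_n -> nat} := [ffun i => val (g i)].
have [g _ g_max] :=
  arg_maxnP (fun g : I => F_at k (emb g)) (erefl : predT [ffun=> ord0]).
exists (emb g).
have -> : k.+1 ^ n = #|I| by rewrite card_ffun !card_ord.
rewrite -size_positions -sum1_size -sum_nat_const.
apply: (@leq_trans (\sum_(g' : I) F_at k (emb g'))); last first.
  by apply: leq_sum => g' _; apply: g_max.
rewrite /F_at; under [leqRHS]eq_bigr do rewrite -sum1_count big_mkcond.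
rewrite exchange_big /= big_seq [leqRHS]big_seq.
apply: leq_sum => p /mem_positions/sum_heights p_k.
have p_lt i : heights p i < k.+1 by rewrite ltnS -p_k (bigD1 i) //= leq_addr.
rewrite (bigD1 [ffun i => Ordinal (p_lt i)]) //= ifT //.
by apply/eqP/ffunP => i; rewrite [RHS]ffunE [in RHS]ffunE.
Qed.

(** * Stacking positions and supermultiplicativity *)

Definition swap (b : bool) n (p : position n) : position n :=
  [ffun i => map (addb b) (p i)].

Definition cat_position n (p q : position n) : position n :=
  [ffun i => p i ++ q i].

(** The moves of [q] are replayed on top of [p]; after an odd number of moves yellow comes first,
    hence the swap. *)
Lemma reachable_cat n k m (p q : position n) :
    reachable_in k p -> reachable_in m q ->
  reachable_in (k + m) (cat_position p (swap (odd k) q)).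
Proof.
move=> p_k; elim=> [|{}m {}q i _ IHq].
  rewrite addn0.
  suff -> : cat_position p (swap (odd k) (empty_board n)) = p by [].
  by apply/ffunP => i; rewrite !ffunE cats0.
rewrite addnS; set r := cat_position p _.
suff -> : r = insert (cat_position p (swap (odd k) q)) i (turn (k + m)).
  exact: reachable_move.
apply/ffunP => j; rewrite !ffunE; case: ifP => // _.
rewrite map_rcons rcons_cat /turn oddD.
by case: (odd k); case: (odd m).
Qed.

Lemma F_at_mul n k m (h g : {ffun 'I_n -> nat}) :
  F_at k h * F_at m g <= F_at (k + m) [ffun i => h i + g i].
Proof.
rewrite {1 2}/F_at -!size_filter.
set s := seq.filter _ _; set t := seq.filter _ _.
have s_good p : p \in s -> reachable_in k p /\ heights p = h.
  by rewrite mem_filter => /andP[/eqP ? /mem_positions].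
have t_good p : p \in t -> reachable_in m p /\ heights p = g.
  by rewrite mem_filter => /andP[/eqP ? /mem_positions].
pose f (p q : position n) := cat_position p (swap (odd k) q).
rewrite -(size_allpairs f); apply: size_le_F_at.
  apply: allpairs_uniq; rewrite ?filter_uniq ?positions_uniq //.
  move=> _ _ /allpairsP[[p q] /= [ps qt ->]] /allpairsP[[p' q'] /= [ps' qt' ->]].
  move=> /= /ffunP eq_f.
  (* Both lower parts have height [h i] in column [i], so equal stacked columns split at the same
     cell. *)
  have eq_pq i :
      (p i == p' i) && (map (addb (odd k)) (q i) == map (addb (odd k)) (q' i)).
    have /eqP := eq_f i; rewrite !ffunE eqseq_cat //.
    have [[_ hp] [_ hp']] := (s_good p ps, s_good p' ps').
    have := congr1 (fun h' : {ffun _} => h' i) (etrans hp (esym hp')).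
    by rewrite !ffunE.
  congr pair; apply/ffunP => i; have /andP[/eqP eq_p /eqP eq_q] := eq_pq i => //.
  exact: (inj_map (@addbI _)) eq_q.
move=> _ /allpairsP[[p q] /= [/s_good[p_k p_h] /t_good[q_m q_g] ->]].
split; first exact: reachable_cat.
by rewrite -p_h -q_g; apply/ffunP => i; rewrite !ffunE size_cat size_map.
Qed.

Lemma F_at_exp n k (h : {ffun 'I_n -> nat}) q :
  F_at k h ^ q <= F_at (q * k) [ffun i => q * h i].
Proof.
elim: q => [|q IHq].
  rewrite expn0 mul0n; apply: (@size_le_F_at n 0 _ [:: empty_board n]) => // p.
  rewrite inE => /eqP ->; split; first exact: reachable_empty.
  by apply/ffunP => i; rewrite !ffunE.
rewrite expnS mulSn; apply: leq_trans (leq_mul (leqnn _) IHq) _.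
apply: leq_trans (F_at_mul _ _ _ _) _.
suff -> : [ffun i => h i + [ffun j => q * h j] i] = [ffun i => q.+1 * h i] by [].
by apply/ffunP => i; rewrite !ffunE mulSn.
Qed.

Lemma exists_reachable n k : exists p : position n.+1, reachable_in k p.
Proof.
elim: k => [|k [p p_k]].
  by exists (empty_board n.+1); apply: reachable_empty.
by exists (insert p ord0 (turn k)); apply: reachable_move.
Qed.

(** Above [q] stacked blocks goes one fixed position with [s] tokens, so that lengths not divisible
    by [k] are reached too. *)
Lemma F_at_expD n k (h : {ffun 'I_n.+1 -> nat}) q s :
  F_at k h ^ q <= F n.+1 (q * k + s).
Proof.
have [p p_s] := exists_reachable n s.
apply: leq_trans (F_at_exp k h q) _.
have F_at_p : 0 < F_at s (heights p).
  by apply: (@size_le_F_at n.+1 s _ [:: p]) => // r; rewrite inE => /eqP ->.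
apply: leq_trans (leq_pmulr _ F_at_p) _.
exact: leq_trans (F_at_mul _ _ _ _) (F_at_le_F _ _).
Qed.

Lemma F_gt0 n k : 0 < F n.+1 k.
(* The exponent [q = 0] makes the left side [1], and [s = k] supplies all the moves. *)
Proof. exact: (F_at_expD 0 [ffun=> 0] 0 k). Qed.

(** * Positions filling a single row *)

Definition row n (A B : {set 'I_n}) : position n :=
  [ffun i => if i \in A then [:: Red] else
             if i \in B then [:: Yellow] else [::]].

(** Induction undoes the last move, which is yellow exactly when an odd number of moves precedes it;
    any column of that color can serve. *)
Lemma reachable_row n k (A B : {set 'I_n}) :
    [disjoint A & B] -> #|A| = uphalf k -> #|B| = k./2 ->
  reachable_in k (row A B).
Proof.
elim: k A B => [|k IHk] A B AB /= cA cB.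
  move/eqP: cA; move/eqP: cB; rewrite !cards_eq0 => /eqP -> /eqP ->.
  suff -> : row finset.set0 finset.set0 = empty_board n.
    exact: reachable_empty.
  by apply/ffunP => i; rewrite !ffunE !inE.
case k_odd : (odd k).
  have [i iB] : exists i, i \in B by apply/card_gt0P; rewrite cB uphalf_half k_odd.
  have iA : i \notin A by rewrite (disjointFl AB).
  have -> : row A B = insert (row A (B :\ i)) i (turn k).
    apply/ffunP => j; rewrite !ffunE !inE /turn k_odd.
    by case: eqVneq => [->|_] /=; rewrite ?(negbTE iA) ?iB.
  apply/reachable_move/IHk.
  - exact: disjointWr (subD1set _ _) AB.
  - by rewrite cA uphalf_half k_odd.
  - by move: cB; rewrite (cardsD1 i B) iB uphalf_half k_odd => -[].
have [i iA] : exists i, i \in A by apply/card_gt0P; rewrite cA.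
have iB : i \notin B by rewrite (disjointFr AB).
have -> : row A B = insert (row (A :\ i) B) i (turn k).
  apply/ffunP => j; rewrite !ffunE !inE /turn k_odd.
  by case: eqVneq => [->|_] /=; rewrite ?(negbTE iB) ?iA.
apply/reachable_move/IHk.
- exact: disjointWl (subD1set _ _) AB.
- by move: cA; rewrite (cardsD1 i A) iA uphalf_half k_odd => -[].
- by rewrite cB uphalf_half k_odd.
Qed.

(** Since [(i + 1) * 'C(n, i + 1) = (n - i) * 'C(n, i)], the coefficients rise while
    [i + 1 <= n - i]; symmetry handles the upper half. *)
Lemma bin_le_central n j : 'C(n, j) <= 'C(n, uphalf n).
Proof.
have up i : i < uphalf n -> 'C(n, i) <= 'C(n, i.+1).
  move=> lt_i; rewrite -(leq_pmul2l (ltn0Sn i)) mul_bin_left leq_mul2r.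
  by apply/orP; right; lia.
have below i d : i + d = uphalf n -> 'C(n, i) <= 'C(n, uphalf n).
  elim: d i => [|d IHd] i; first by rewrite addn0 => ->.
  rewrite addnS -addSn => eq_id; apply: leq_trans (IHd _ eq_id).
  by apply: up; lia.
have [le_j|lt_j] := leqP j (uphalf n).
  by apply: (below j (uphalf n - j)); lia.
have [le_jn|lt_nj] := leqP j n; last by rewrite bin_small.
by rewrite -bin_sub //; apply: (below _ (uphalf n - (n - j))); lia.
Qed.

Lemma expn2_le_F_at n :
  2 ^ n <= n.+1 * F_at n ([ffun=> 1] : {ffun 'I_n -> nat}).
Proof.
have -> : 2 ^ n = \sum_(j < n.+1) 'C(n, j).
  rewrite (expnDn 1 1); by apply: eq_bigr => j _; rewrite !exp1n !muln1.
apply: (@leq_trans (\sum_(j < n.+1) 'C(n, uphalf n))).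
  by apply: leq_sum => j _; apply: bin_le_central.
rewrite sum_nat_const card_ord leq_mul2l /=.
have <- : #|[set A : {set 'I_n} | #|A| == uphalf n]| = 'C(n, uphalf n).
  by rewrite card_draws card_ord.
rewrite cardE -(size_map (fun A : {set 'I_n} => row A (~: A))).
apply: size_le_F_at => [|r /mapP[A]].
  rewrite map_inj_uniq ?enum_uniq // => A B /ffunP eq_AB; apply/setP => i.
  by have := eq_AB i; rewrite !ffunE !inE; case: (i \in A); case: (i \in B).
rewrite mem_enum inE => /eqP A_card ->; split.
  apply: reachable_row => //.
    by rewrite finset.disjoints_subset finset.setCK.
  have := cardsC A; rewrite card_ord A_card; lia.
by apply/ffunP => i; rewrite !ffunE !inE; case: (i \in A).
Qed.

Local Open Scope classical_set_scope.
Local Open Scope ring_scope.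

(** * Logarithms of natural numbers *)

Lemma ln_nat_ge0 (R : realType) (n : nat) : 0 <= ln (n%:R : R).
(* The default value [ln 0 = 0] covers [n = 0], and likewise [m = 0] in the next two lemmas. *)
Proof. by case: n => [|n]; [rewrite ln0 | rewrite ln_ge0 // ler1n]. Qed.

Lemma ler_ln_nat (R : realType) (m n : nat) :
  (m <= n)%N -> ln (m%:R : R) <= ln n%:R.
Proof.
case: m => [|m] le_mn; first by rewrite [leLHS]ln0 // ln_nat_ge0.
by rewrite ler_ln ?ler_nat // posrE ltr0n // (leq_trans _ le_mn).
Qed.

Lemma ln_natX (R : realType) (m n : nat) :
  ln ((m ^ n)%:R : R) = n%:R * ln m%:R.
Proof.
case: m => [|m]; last by rewrite natrX lnXn ?ltr0n // mulr_natl.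
by case: n => [|n]; rewrite ?expn0 ?exp0n // ?ln1 ?mul0r // ln0 // mulr0.
Qed.

Lemma ln_natM (R : realType) (m n : nat) : (0 < m)%N -> (0 < n)%N ->
  ln ((m * n)%:R : R) = ln m%:R + ln n%:R.
Proof. by move=> m0 n0; rewrite natrM lnM // posrE ltr0n. Qed.

Lemma cvg_ln_succ_div (R : realType) :
  ln (k.+1%:R : R) / k%:R @[k --> \oo] --> (0 : R).
Proof.
apply/cvgrPdist_le => e e0.
(* The bound [ln y <= y - 1] at [y = (k + 1) / M] has slope [e / 2] in [k]; the other [e / 2]
   absorbs the constants for large [k]. *)
pose M := 2 / e; have M0 : 0 < M by rewrite divr_gt0.
have lnM_le k : ln (k.+1%:R : R) <= ln M + k.+1%:R / M.
  have k0 : 0 < k.+1%:R / M :> R by rewrite divr_gt0 // ltr0n.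
  rewrite -[X in ln X <= _](divfK (lt0r_neq0 M0)) mulrC lnM ?posrE // lerD2l.
  rewrite -[X in ln X](subrKC 1); apply: le_trans (le_ln1Dx _) _; lra.
near=> k.
have k0 : 0 < k%:R :> R by rewrite ltr0n; near: k; apply: nbhs_infty_gt.
rewrite sub0r normrN ger0_norm ?divr_ge0 ?ln_nat_ge0 // ler_pdivrMr //.
apply: le_trans (lnM_le k) _.
have -> : k.+1%:R / M = (k%:R + 1) * (e / 2) :> R.
  by rewrite -natr1 /M invf_div.
have : (ln M + e / 2) / (e / 2) <= k%:R by near: k; apply: nbhs_infty_ger.
by rewrite ler_pdivrMr ?divr_gt0 //; lra.
Unshelve. all: by end_near. Qed.

(** * Existence and bounds of the exponential rate *)

Definition F_at_rates (R : realType) n : set R :=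
  [set x | exists k (h : {ffun 'I_n -> nat}),
    (0 < k)%N /\ x = ln (F_at k h)%:R / k%:R].
Arguments F_at_rates : clear implicits.

(** For [n > 0] this is the logarithm of [growth_rate R n]; as a supremum it is available before
    convergence is known. *)
Definition entropy (R : realType) n : R := sup (F_at_rates R n).

Lemma F_at_rates_ub (R : realType) n : ubound (F_at_rates R n) (ln 2).
Proof.
move=> _ [k [h [k0 ->]]]; rewrite ler_pdivrMr ?ltr0n //.
by rewrite mulrC -ln_natX ler_ln_nat // F_at_le_expn.
Qed.

Lemma F_at_rates_nonempty (R : realType) n : F_at_rates R n !=set0.
Proof. by eexists; exists 1%N, [ffun=> 0%N]; split. Qed.

Lemma F_at_rate_le_entropy (R : realType) n k (h : {ffun 'I_n -> nat}) :
  (0 < k)%N -> ln (F_at k h)%:R / k%:R <= entropy R n.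
Proof.
move=> k0; apply: ub_le_sup; first by exists (ln 2); apply: F_at_rates_ub.
by exists k, h.
Qed.

Lemma entropy_le (R : realType) n : entropy R n <= ln 2.
Proof. exact: ge_sup (F_at_rates_nonempty R n) (@F_at_rates_ub R n). Qed.

Lemma entropy_ge (R : realType) n :
  ln 2 - ln n.+2%:R / n.+1%:R <= entropy R n.+1.
Proof.
apply: le_trans (F_at_rate_le_entropy R [ffun=> 1%N] (ltn0Sn n)).
rewrite lerBlDr -mulrDl ler_pdivlMr ?ltr0n // mulrC -ln_natX.
have le_G := expn2_le_F_at n.+1.
have Fat0 : (0 < F_at n.+1 ([ffun=> 1%N] : {ffun 'I_n.+1 -> nat}))%N.
  by move: le_G; case: F_at => //; rewrite muln0 leqn0 expn_eq0.
by rewrite addrC -ln_natM // ler_ln_nat.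
Qed.

(* Fekete's argument: the polynomial factor in [F_le_F_at] disappears in the
   limit, and [F_at_expD] shows that every rate of [F_at] is eventually
   reached. *)
Lemma ln_F_cvg (R : realType) n :
  ln ((F n.+1 k)%:R : R) / k%:R @[k --> \oo] --> entropy R n.+1.
Proof.
apply/cvgrPdist_le => e e0.
have e2 : 0 < e / 2 by rewrite divr_gt0.
have [|_ [k [h [k0 ->]]] rate_gt] := sup_adherent e2 (E := F_at_rates R n.+1).
  by split; [exact: F_at_rates_nonempty | exists (ln 2); exact: F_at_rates_ub].
rewrite -/(entropy R n.+1) in rate_gt.
set C := ln (F_at k h)%:R in rate_gt.
have C0 : 0 <= C by apply: ln_nat_ge0.
have log_cvg : (n.+1%:R * (ln (j.+1%:R : R) / j%:R)) @[j --> \oo] --> (0 : R).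
  by rewrite -[X in _ --> X](mulr0 n.+1%:R); apply: cvgMr; apply: cvg_ln_succ_div.
near=> j.
have j0 : (0 < j)%N by near: j; apply: nbhs_infty_gt.
have jR : 0 < j%:R :> R by rewrite ltr0n.
have kR : 0 < k%:R :> R by rewrite ltr0n.
rewrite ler_norml; apply/andP; split.
  (* Upper bound: [F] exceeds a single [F_at j g] by at most a polynomial factor. *)
  have [g F_le] := F_le_F_at n.+1 j.
  have Fat0 : (0 < F_at j g)%N.
    by move: (F_gt0 n j) F_le; case: (F_at j g) => //; rewrite muln0 leqn0; case: F.
  have := ler_ln_nat R F_le.
  rewrite ln_natM ?expn_gt0 // ln_natX => lnF_le.
  have : n.+1%:R * (ln (j.+1%:R : R) / j%:R) <= e.
    near: j.
    by have /cvgrPdist_le/(_ e e0) := log_cvg; apply: filterS => j;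
       rewrite sub0r normrN; apply: le_trans; apply: ler_norm.
  have := F_at_rate_le_entropy R g j0.
  have : ln (F n.+1 j)%:R / j%:R <=
      n.+1%:R * (ln j.+1%:R / j%:R) + ln (F_at j g)%:R / j%:R :> R.
    by rewrite mulrA -mulrDl ler_pM2r ?invr_gt0.
  lra.
have C_small : C / j%:R <= e / 2.
  rewrite ler_pdivrMr // -ler_pdivrMl // mulrC.
  by near: j; apply: nbhs_infty_ger.
(* Lower bound: the quotient [j %/ k] falls short of the real ratio by less than [1], which costs at
   most [C / j]. *)
have : C / k%:R - C / j%:R <= ln (F n.+1 j)%:R / j%:R.
  have := ler_ln_nat R (F_at_expD k h (j %/ k) (j %% k)).
  rewrite -divn_eq ln_natX -/C => lnF_ge.
  rewrite lerBlDr -mulrDl ler_pdivlMr // mulrAC ler_pdivrMr //.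
  apply: le_trans (_ : C * ((j %/ k).+1 * k)%:R <= _).
    by rewrite ler_wpM2l // ler_nat ltnW // ltn_ceil.
  by rewrite natrM mulrA ler_pM2r // -natr1 mulrDr mulr1 mulrC lerD2r.
lra.
Unshelve. all: by end_near. Qed.

Lemma growth_rate_entropy (R : realType) n :
  growth_rate R n.+1 = expR (entropy R n.+1).
Proof.
apply/cvg_lim => //.
have -> : (fun k => (F n.+1 k)%:R `^ k%:R^-1 : R) =
    expR \o (fun k => ln (F n.+1 k)%:R / k%:R).
  apply/funext => k /=; rewrite /powR pnatr_eq0 gtn_eqF ?F_gt0 //.
  by rewrite mulrC.
apply: continuous_cvg; first exact: continuous_expR.
exact: ln_F_cvg.
Qed.

Theorem theorem9 (R : realType) :
  growth_rate R n @[n --> \oo] --> (2 : R).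
Proof.
(* The shift discards the board without columns, where no move exists. *)
rewrite -(cvg_shiftS (growth_rate R)).
under eq_fun do rewrite growth_rate_entropy.
(* Writing [2] as [expR (ln 2)] leaves the entropies to be squeezed towards [ln 2]. *)
rewrite -[2%R](@lnK R) ?posrE //.
apply: continuous_cvg; first exact: continuous_expR.
apply: (squeeze_cvgr (f := fun n => ln 2 - ln n.+2%:R / n.+1%:R)
                     (h := fun=> ln 2)).
- by apply: nearW => n; rewrite entropy_ge entropy_le.
- rewrite -[X in _ --> X]subr0; apply: cvgB; first exact: cvg_cst.
  by have := @cvg_ln_succ_div R; rewrite -cvg_shiftS.
- exact: cvg_cst.
Qed.
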